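(* For any positive integer $n$, $|\Upsilon_{K_n,odd}|=a_{n+1}$, where $\Upsilon_{K_n,odd}$ is the set of odd $K_n$-partitionable permutations, $K_n$ is the complete graph with vertex set $[n]=\{1,\dots,n\}$, and $a_{n+1}$ is the number of alternating permutations on $[n+1]$.
   Context: Alternating permutations. A permutation $\sigma$ of $[n]$ is alternating if $\sigma(1)>\sigma(2)<\sigma(3)>\sigma(4)<\cdots\sigma(n)$. $A_n$ denotes the set of alternating permutations on $[n]$, and $a_n=|A_n|$. Odd $H$-permutations. Let $H$ be a simple graph (possibly disconnected) on a finite totally ordered vertex set with $m$ elements, and let $\sigma=a_1a_2\cdots a_m$ be a permutation of $V(H)$ in one-line notation such that $a_1$ is the maximum vertex. For $2\le i\le m$ let $j=\max\{k : 1\le k<i,\ a_k>a_i\}$ and $\tilde N_{\sigma,i}=\{k : j\le k<i,\ a_ka_i\in E(H)\}$. Let $E_1=\emptyset$; for $i\ge2$ let $E_i=E_{i-1}$ if $\tilde N_{\sigma,i}=\emptyset$, and otherwise $E_i=E_{i-1}\cup\{a_{k_0}a_i\}$ with $k_0=\min\tilde N_{\sigma,i}$. Let $F_\sigma$ be the spanning forest of $H$ with edge set $E_m$. The permutation $\sigma$ is an odd $H$-permutation if $F_\sigma$ is a spanning tree of $H$ and $|\tilde N_{\sigma,i}|$ is odd for all $2\le i\le m$. Basic decomposition. For a permutation $\sigma=a_1\cdots a_n$ (one-line notation), let $a_{i_1}$ be the maximum of all the entries, and $\sigma_1=a_{i_1}a_{i_1+1}\cdots a_n$; let $a_{i_2}$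 be the maximum of $\{a_1,\dots,a_{i_1-1}\}$ and $\sigma_2=a_{i_2}\cdots a_{i_1-1}$; and so on until all entries are used. The resulting factorization $\sigma=\sigma_t\sigma_{t-1}\cdots\sigma_1$ is the basic decomposition of $\sigma$. Odd $G$-partitionable permutations. Let $G$ be a simple connected graph with vertex set $[n]$. A permutation $\sigma$ of $[n]$ with basic decomposition $\sigma_t\cdots\sigma_1$ is an odd $G$-partitionable permutation if, for every $1\le i\le t$, $\sigma_i$ is an odd $G_i$-permutation, where $G_i$ is the subgraph of $G$ induced by the vertices appearing in $\sigma_i$ (with the inherited vertex order). The set of these is $\Upsilon_{G,odd}$. *)

(* Defs.v *)
From mathcomp Require Import all_boot all_order all_fingroup.

Set Implicit Arguments.
Unset Strict Implicit.
Unset Printing Implicit Defensive.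

Import Order.TTheory.

(* A simple graph whose vertices lie in an ambient finite type [T]; the vertex
   set [vset] need not be all of [T], so that induced subgraphs on a subset
   (and the vertex order they inherit from [T]) stay over the same type. *)
Record sgraph (T : finType) := SGraph {
  vset : {set T};
  eset : {set {set T}};
  esetP : forall A, A \in eset -> (A \subset vset) && (#|A| == 2)
}.

Definition adj (T : finType) (G : sgraph T) : rel T :=
  [rel x y | [set x; y] \in eset G].

Definition connected (T : finType) (G : sgraph T) : bool :=
  (vset G != set0) &&
  [forall x in vset G, forall y in vset G, connect (adj G) x y].

(* No cycle of length at least 3.  The length is bounded by [#|T|] only to make
   this a boolean: see [acyclicP]. *)
Definition acyclic (T : finType) (G : sgraph T) : bool :=
  [forall k : 'I_#|T|.+1, (2 < k) ==>
     [forall c : k.-tuple T, ~~ ucycleb (adj G) c]].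

Lemma acyclicP (T : finType) (G : sgraph T) :
  reflect (forall c : seq T, 2 < size c -> ~ ucycle (adj G) c) (acyclic G).
Proof.
apply: (iffP forallP) => [acG c c_gt2 cycc | acG k].
  have c_le : size c < #|T|.+1.
    by case/andP: cycc => _ /card_uniqP <-; rewrite ltnS max_card.
  have /implyP/(_ c_gt2)/forallP/(_ (in_tuple c)) := acG (Ordinal c_le).
  by rewrite [ucycleb _ _]cycc.
apply/implyP => k_gt2; apply/forallP => c; apply/negP; apply: acG.
by rewrite size_tuple.
Qed.

Definition is_tree (T : finType) (G : sgraph T) : bool :=
  connected G && acyclic G.

Definition spanning_tree (T : finType) (F H : sgraph T) : bool :=
  [&& vset F == vset H, eset F \subset eset H & is_tree F].

Lemma induced_subproof (T : finType) (G : sgraph T) (A B : {set T}) :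
  B \in [set C in eset G | C \subset A] ->
  (B \subset vset G :&: A) && (#|B| == 2).
Proof. by rewrite inE subsetI => /andP[/esetP/andP[-> ->] ->]. Qed.

Definition induced (T : finType) (G : sgraph T) (A : {set T}) : sgraph T :=
  SGraph (@induced_subproof T G A).

Lemma complete_subproof (T : finType) (B : {set T}) :
  B \in [set C : {set T} | #|C| == 2] ->
  (B \subset [set: T]) && (#|B| == 2).
Proof. by rewrite inE subsetT. Qed.

Definition complete (T : finType) : sgraph T :=
  SGraph (@complete_subproof T).

(* Throughout, positions in a word are numbered from 0: the entry a_(i+1) of
   the one-line notation is [nth x0 s i], and [x0] is only a default value. *)

(* The value on an empty range is 0; the range is nonempty for 0 < i < size s
   when [s] is duplicate-free and its first entry is its maximum. *)
Definition last_greater (d : Order.disp_t) (T : finOrderType d)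
    (x0 : T) (s : seq T) (i : nat) : nat :=
  \max_(0 <= k < i | (nth x0 s i < nth x0 s k)%O) k.

(* The set Ntilde_(s,i), listed in increasing order. *)
Definition Ntilde (d : Order.disp_t) (T : finOrderType d)
    (H : sgraph T) (x0 : T) (s : seq T) (i : nat) : seq nat :=
  [seq k <- index_iota (last_greater x0 s i) i
     | adj H (nth x0 s k) (nth x0 s i)].

Fixpoint forest_edges {d : Order.disp_t} {T : finOrderType d}
    (H : sgraph T) (x0 : T) (s : seq T) (i : nat)
    : {set {set T}} :=
  if i is i'.+1 then
    if Ntilde H x0 s i is k0 :: _
    then [set nth x0 s k0; nth x0 s i] |: forest_edges H x0 s i'
    else forest_edges H x0 s i'
  else set0.

Lemma forest_edges_sub (d : Order.disp_t) (T : finOrderType d)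
    (H : sgraph T) (x0 : T) (s : seq T) (i : nat) :
  forest_edges H x0 s i \subset eset H.
Proof.
elim: i => [|i IHi]; first exact: sub0set.
rewrite [forest_edges _ _ _ _]/=.
case EN: (Ntilde H x0 s i.+1) => [|k0 N] //.
rewrite subUset IHi andbT sub1set.
have: k0 \in Ntilde H x0 s i.+1 by rewrite EN mem_head.
by rewrite mem_filter => /andP[].
Qed.

Lemma forest_subproof (d : Order.disp_t) (T : finOrderType d)
    (H : sgraph T) (x0 : T) (s : seq T) (A : {set T}) :
  A \in forest_edges H x0 s (size s).-1 ->
  (A \subset vset H) && (#|A| == 2).
Proof. by move/(subsetP (forest_edges_sub H x0 s _))/esetP. Qed.

Definition forest (d : Order.disp_t) (T : finOrderType d)
    (H : sgraph T) (x0 : T) (s : seq T) : sgraph T :=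
  SGraph (@forest_subproof d T H x0 s).

Definition odd_perm_of (d : Order.disp_t) (T : finOrderType d)
    (H : sgraph T) (s : seq T) : bool :=
  if s is x0 :: _ then
    [&& perm_eq s (enum (vset H)),
        [forall v in vset H, (v <= x0)%O],
        spanning_tree (forest H x0 s) H
      & all (fun i => odd (size (Ntilde H x0 s i))) (index_iota 1 (size s))]
  else false.

(* Returns the factors in the order sigma_1, sigma_2, ..., sigma_t, i.e. from
   right to left in the word.  [fuel] bounds the number of factors; [size s] is
   always enough. *)
Fixpoint basic_decomp_rec {d : Order.disp_t} {T : finOrderType d}
    (fuel : nat) (s : seq T) : seq (seq T) :=
  if fuel is fuel'.+1 then
    if s is x :: s' then
      let i := index (foldr Order.max x s') s in
      drop i s :: basic_decomp_rec fuel' (take i s)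
    else [::]
  else [::].

Definition basic_decomp (d : Order.disp_t) (T : finOrderType d)
    (s : seq T) : seq (seq T) :=
  basic_decomp_rec (size s) s.

Lemma basic_decompK (d : Order.disp_t) (T : finOrderType d)
    (s : seq T) : flatten (rev (basic_decomp s)) = s.
Proof.
rewrite /basic_decomp; have: size s <= size s by [].
move: {2 3}(size s) => n; elim: n s => [|n IHn] [|x s] // le_sn.
rewrite [basic_decomp_rec _ _]/=; set m := foldr _ _ _.
have lt_m : index m (x :: s) < size (x :: s).
  rewrite index_mem /m; elim: (s) => [|y s' IHs] /=; first exact: mem_head.
  rewrite maxElt; case: ifP => _; last by rewrite !inE eqxx orbT.
  by move: IHs; rewrite !inE => /orP[] ->; rewrite ?orbT.
rewrite -[if _ then _ else _]/(index m (x :: s)).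
move: (index _ _) lt_m => i lt_i.
rewrite rev_cons flatten_rcons IHn ?cat_take_drop // size_take lt_i.
by rewrite -ltnS (leq_trans lt_i).
Qed.

Definition one_line (n : nat) (s : 'S_n) : seq 'I_n :=
  [seq s i | i <- enum 'I_n].

(* The vertex set {1, ..., n} is represented by ['I_n] = {0, ..., n-1}. *)
Definition Upsilon_odd (n : nat) (G : sgraph 'I_n) : {set 'S_n} :=
  [set s : 'S_n |
    all (fun b => odd_perm_of (induced G [set x in b]) b)
        (basic_decomp (one_line s))].

Definition K (n : nat) : sgraph 'I_n := complete 'I_n.

Lemma K_connected (n : nat) :
  0 < n -> (vset (K n) == [set: 'I_n]) && connected (K n).
Proof.
move=> n_gt0; apply/and3P; split; first exact: eqxx.
- by apply/set0Pn; exists (Ordinal n_gt0); rewrite inE.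
- apply/forall_inP => x _; apply/forall_inP => y _.
  have [-> | neq_xy] := eqVneq x y; first exact: connect0.
  by apply: connect1; rewrite /adj /= inE cards2 neq_xy.
Qed.

(* Positions are numbered from 0, so descents occur at even positions. *)
Definition alternating (n : nat) : {set 'S_n} :=
  [set s : 'S_n |
    [forall i : 'I_n, forall j : 'I_n, (j == i.+1 :> nat) ==>
      (if odd i then s i < s j else s j < s i)]].

Definition num_alternating (n : nat) : nat := #|alternating n|.

(* Main.v *)
Require Import Defs.
From mathcomp Require Import all_boot all_order all_fingroup zify.

(* In K_n every forest F_sigma is a spanning tree, so the odd K_n-partitionable
   permutations are the words in which every entry that is not a left-to-right
   maximum lies at odd distance from the last greater entry before it.  Let U be
   the exponential generating function of these words, and V the one of the
   words that satisfy the condition for all entries once a maximum is put in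
   front.  Cutting at the maximum gives U' = U V and V' = V_even V.  The
   down-up words A satisfy A' = A_even A for the same reason, so V = A, and then
   A'' = A' A shows that U = A'. *)

Set Implicit Arguments.
Unset Strict Implicit.
Unset Printing Implicit Defensive.

Import Order.TTheory.

(** * Words counted up to relative order *)

Definition nwords (P : pred (seq nat)) (n : nat) : nat :=
  count P (permutations (iota 0 n)).

(** [f] has to preserve the order only on the entries of [s], so it can be a relabelling of one
    finite set of values by another. *)
Definition order_invariant (P : pred (seq nat)) : Prop :=
  forall (f : nat -> nat) (s : seq nat),
    {in s &, {mono f : x y / x < y}} -> P (map f s) = P s.

Lemma permutations_map (T1 T2 : eqType) (f : T1 -> T2) (s : seq T1) :
  uniq s -> {in s &, injective f} ->
  perm_eq (permutations (map f s)) (map (map f) (permutations s)).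
Proof.
move=> Us injf; have Umap : uniq (map (map f) (permutations s)).
  rewrite map_inj_in_uniq ?permutations_uniq // => t u.
  rewrite !mem_permutations => /perm_mem est /perm_mem esu.
  by apply: (inj_in_map injf); apply/allP => x; rewrite ?est ?esu.
rewrite perm_sym; apply: uniq_perm; rewrite ?permutations_uniq //.
apply: (uniq_min_size Umap _ _).2 => [w|].
  case/mapP=> t; rewrite !mem_permutations => est ->; exact: perm_map.
by rewrite size_map !size_permutations ?size_map // map_inj_in_uniq.
Qed.

Lemma count_permutations_map (f : nat -> nat) (P : pred (seq nat)) (s : seq nat) :
  uniq s -> {in s &, injective f} ->
  count P (permutations (map f s)) = count (preim (map f) P) (permutations s).
Proof. by move=> Us injf; rewrite (seq.permP (permutations_map Us injf)) count_map. Qed.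

(** Sorting [s] into [t] makes [nth 0 t] an increasing relabelling of [iota 0 (size s)] by the
    entries of [s], and [P] does not see the relabelling. *)
Lemma count_permutations (P : pred (seq nat)) (s : seq nat) :
  order_invariant P -> uniq s -> count P (permutations s) = nwords P (size s).
Proof.
move=> invP Us; set t := sort leq s.
have pst : perm_eq t s by rewrite /t perm_sort.
rewrite -(seq.permP (perm_permutations pst)) -(perm_size pst).
have lt_t : sorted ltn t.
  by rewrite ltn_sorted_uniq_leq /t sort_uniq Us sort_sorted //; apply: leq_total.
have monot : {in iota 0 (size t) &, {mono nth 0 t : x y / x < y}}.
  move=> i j; rewrite !mem_iota /= => lt_i lt_j.
  have lt_nth := sorted_ltn_nth ltn_trans 0 lt_t.
  have [lt_ij|lt_ji|->] := ltngtP i j; last by rewrite ltnn.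
  - exact: lt_nth.
  - by apply/negbTE; rewrite -leqNgt; apply/ltnW/lt_nth.
rewrite -{1}(mkseq_nth 0 t) count_permutations_map ?iota_uniq //; last first.
  move=> i j; rewrite !mem_iota /= => lt_i lt_j /eqP.
  by rewrite nth_uniq ?(perm_uniq pst) // => /eqP.
apply: eq_in_count => w /=; rewrite mem_permutations => /perm_mem ew.
by apply: invP => i j; rewrite !ew; apply: monot.
Qed.

(** * Cutting words at their maximum *)

Definition prefix_set (n : nat) (w : seq nat) : {set 'I_n} :=
  [set i : 'I_n | (val i) \in take (index n w) w].

Lemma take_index_cat (T : eqType) (l r : seq T) (m : T) :
  m \notin l -> take (index m (l ++ m :: r)) (l ++ m :: r) = l.
Proof.
by move=> nml; rewrite index_cat (negbTE nml) /= eqxx addn0 take_size_cat.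
Qed.

Lemma mem_val_enum (n : nat) (A : {set 'I_n}) (i : 'I_n) :
  (val i \in map val (enum A)) = (i \in A).
Proof. by rewrite mem_map ?mem_enum //; apply: val_inj. Qed.

Lemma val_enum_lt (n : nat) (A : {set 'I_n}) (x : nat) :
  x \in map val (enum A) -> x < n.
Proof. by case/mapP => i _ ->; apply: ltn_ord. Qed.

(** In a word on 0, ..., n the letter [n] occurs once, so the word amounts to an arrangement [l] of
    the letters before it and an arrangement [r] of those after it; [A] records which letters go to
    the left. *)
Lemma permutations_split (n : nat) (A : {set 'I_n}) :
  perm_eq [seq w <- permutations (iota 0 n.+1) | prefix_set n w == A]
    [seq l ++ n :: r | l <- permutations (map val (enum A)),
                       r <- permutations (map val (enum (~: A)))].
Proof.
have nval l B : l \in permutations (map val (enum (B : {set 'I_n}))) -> n \notin l.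
  rewrite mem_permutations => /perm_mem El; rewrite El; apply/negP.
  by move/val_enum_lt; rewrite ltnn.
apply: uniq_perm; first by rewrite filter_uniq ?permutations_uniq.
  apply: allpairs_uniq; rewrite ?permutations_uniq //.
  move=> _ _ /allpairsP[[l r] [/= lA _ ->]] /allpairsP[[l' r'] [/= l'A _ ->]] /= E.
  have := take_index_cat r (nval _ _ lA).
  rewrite E take_index_cat ?(nval _ _ l'A) // => El.
  move: E; rewrite El => /eqP; rewrite eqseq_cat // eqxx /= eqseq_cons eqxx.
  by move/eqP->.
have perm_iota l r : perm_eq l (map val (enum A)) ->
    perm_eq (l ++ n :: r) (iota 0 n.+1) = perm_eq r (map val (enum (~: A))).
  move=> El; have Esplit : perm_eq (map val (enum A) ++ n :: map val (enum (~: A)))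
                                   (iota 0 n.+1).
    rewrite -cat1s perm_catCA -addn1 iotaD /= add0n cats1.
    rewrite perm_sym perm_rcons perm_sym perm_cons.
    rewrite -val_enum_ord -map_cat; apply: perm_map; apply: uniq_perm.
    - rewrite cat_uniq !enum_uniq andbT /=; apply/hasPn => i.
      by rewrite !mem_enum inE.
    - exact: enum_uniq.
    - by move=> i; rewrite mem_cat !mem_enum !inE orbN.
  by rewrite -(permPr Esplit) (permPl (perm_cat El (perm_refl _)))
             perm_cat2l perm_cons.
move=> w; rewrite mem_filter mem_permutations; apply/andP/allpairsP.
  case=> /eqP prefA pw; have nw : n \in w by rewrite (perm_mem pw) mem_iota /= add0n.
  have Uw : uniq w by rewrite (perm_uniq pw) iota_uniq.
  case/splitPr: w / nw pw prefA Uw => l r pw prefA Uw.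
  have nl : n \notin l.
    by move: Uw; rewrite cat_uniq /= negb_or => /and3P[_ /andP[]].
  have pl : perm_eq l (map val (enum A)).
    apply: uniq_perm.
    - by move: Uw; rewrite cat_uniq => /andP[].
    - by rewrite map_inj_uniq ?enum_uniq //; apply: val_inj.
    - move=> x; have [lt_xn|le_nx] := ltnP x n.
        rewrite -[x]/(val (Ordinal lt_xn)) mem_val_enum -prefA inE.
        by rewrite take_index_cat.
      have -> : (x \in map val (enum A)) = false.
        by apply/negP => /val_enum_lt; rewrite ltnNge le_nx.
      apply/negP => xl; have := perm_mem pw x; rewrite mem_cat xl mem_iota /= add0n.
      rewrite ltnS => /esym le_xn; case/negP: nl.
      by rewrite (_ : n = x) //; apply/eqP; rewrite eqn_leq le_nx le_xn.
  by exists (l, r); rewrite !mem_permutations /= -(perm_iota _ r pl).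
case=> [[l r] [/= lA rA ->]]; split; last first.
  by rewrite perm_iota -mem_permutations.
apply/eqP/setP => i; rewrite inE take_index_cat ?(nval _ _ lA) //.
by move: lA; rewrite mem_permutations => /perm_mem ->; rewrite mem_val_enum.
Qed.

Lemma sum_powerset_card (n : nat) (g : nat -> nat) :
  \sum_(A : {set 'I_n}) g #|A| = \sum_(k < n.+1) 'C(n, k) * g k.
Proof.
have le_card (A : {set 'I_n}) : #|A| < n.+1 by rewrite ltnS (leq_trans (max_card _)) ?card_ord.
rewrite (partition_big (fun A => Ordinal (le_card A)) xpredT) //=.
apply: eq_bigr => k _.
rewrite (eq_bigr (fun=> g k)) => [|A /eqP <- //].
rewrite sum_nat_const; congr (_ * _).
have := card_draws 'I_n k; rewrite card_ord => <-.
by apply: eq_card => A; rewrite !inE.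
Qed.

(** Words are grouped by the set [A] of letters left of the maximum. Order invariance makes both
    factors depend only on the size of [A], and the binomial coefficient counts the sets of that
    size. *)
Lemma nwords_split (P Q R : pred (seq nat)) :
  order_invariant Q -> order_invariant R ->
  (forall l m r, uniq l -> uniq r -> all (gtn m) l -> all (gtn m) r ->
     P (l ++ m :: r) = Q l && R r) ->
  forall n, nwords P n.+1 = \sum_(k < n.+1) 'C(n, k) * (nwords Q k * nwords R (n - k)).
Proof.
move=> invQ invR splitP n.
have val_uniq (A : {set 'I_n}) : uniq (map val (enum A)).
  by rewrite map_inj_uniq ?enum_uniq //; apply: val_inj.
rewrite -(sum_powerset_card n (fun k => nwords Q k * nwords R (n - k))).
rewrite {1}/nwords -sum1_count (partition_big (prefix_set n) xpredT) //=.
apply: eq_bigr => A _.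
have -> : n - #|A| = #|~: A|.
  by rewrite -[X in X - _](card_ord n) cardsCs subKn ?max_card.
rewrite !cardE -!(size_map val) -!count_permutations // sum1_count.
transitivity (count P [seq w <- permutations (iota 0 n.+1) | prefix_set n w == A]).
  by rewrite count_filter; apply: eq_count => w /=.
rewrite (seq.permP (permutations_split A)).
rewrite -sum1_count big_mkcond big_allpairs_dep -[count Q _]sum1_count big_distrl /=.
rewrite [RHS]big_mkcond big_seq [RHS]big_seq; apply: eq_bigr => l.
rewrite mem_permutations => pl; rewrite mul1n -sum1_count -big_mkcond.
have {}splitP r : r \in permutations (map val (enum (~: A))) ->
    P (l ++ n :: r) = Q l && R r.
  rewrite mem_permutations => pr.
  apply: splitP; rewrite ?(perm_uniq pl) ?(perm_uniq pr) //.
  - by apply/allP => x; rewrite (perm_mem pl) => /val_enum_lt.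
  - by apply/allP => x; rewrite (perm_mem pr) => /val_enum_lt.
case Ql: (Q l); last first.
  by rewrite big_seq_cond big_pred0 // => r; apply/andP => -[/splitP ->]; rewrite Ql.
rewrite big_seq_cond [RHS]big_seq_cond; apply: eq_bigl => r.
by case: (boolP (r \in _)) => //= /splitP ->; rewrite Ql.
Qed.

Lemma nwords_even (P : pred (seq nat)) (n : nat) :
  nwords (fun w => P w && ~~ odd (size w)) n = if odd n then 0 else nwords P n.
Proof.
have sz w : w \in permutations (iota 0 n) -> size w = n.
  by rewrite mem_permutations => /perm_size ->; rewrite size_iota.
case: ifP => odd_n.
  rewrite -(count_pred0 (permutations (iota 0 n))).
  by apply: eq_in_count => w /sz ->; rewrite odd_n andbF.
by apply: eq_in_count => w /sz ->; rewrite odd_n andbT.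
Qed.

Lemma order_invariant_even (P : pred (seq nat)) :
  order_invariant P -> order_invariant (fun w => P w && ~~ odd (size w)).
Proof. by move=> invP f s monof; rewrite invP ?size_map. Qed.

(** * Zigzag words *)

Fixpoint zigzag (up : bool) (s : seq nat) : bool :=
  if s is x :: s' then
    (if s' is y :: _ then if up then x < y else y < x else true)
      && zigzag (~~ up) s'
  else true.

Lemma zigzag_invariant (up : bool) : order_invariant (zigzag up).
Proof.
move=> f s; elim: s up => //= x s IHs up monof.
rewrite IHs; last by move=> y z ys zs; apply: monof; rewrite inE (ys, zs) orbT.
by case: s {IHs} monof => //= y s monof; rewrite !monof // !inE eqxx ?orbT.
Qed.

Lemma zigzag_map_anti (f : nat -> nat) (up : bool) (s : seq nat) :
  {in s &, forall x y, (f x < f y) = (y < x)} ->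
  zigzag up (map f s) = zigzag (~~ up) s.
Proof.
elim: s up => //= x s IHs up antif.
rewrite IHs; last by move=> y z ys zs; apply: antif; rewrite inE (ys, zs) orbT.
by case: s {IHs} antif => //= y s antif; rewrite !antif ?inE ?eqxx ?orbT //; case: up.
Qed.

Lemma nwords_zigzag_negb (up : bool) (n : nat) :
  nwords (zigzag (~~ up)) n = nwords (zigzag up) n.
Proof.
(* [f] reverses the letters 0, ..., n-1, hence swaps ascents and descents. *)
pose f x := n - x.+1.
have injf : {in iota 0 n &, injective f}.
  by move=> x y; rewrite !mem_iota /f /= => ? ?; lia.
have anti : {in iota 0 n &, forall x y, (f x < f y) = (y < x)}.
  by move=> x y; rewrite !mem_iota /f /= => ? ?; lia.
have Ef : perm_eq (map f (iota 0 n)) (iota 0 n).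
  have Uf : uniq (map f (iota 0 n)) by rewrite map_inj_in_uniq ?iota_uniq.
  apply: uniq_perm; rewrite ?iota_uniq //.
  apply: (uniq_min_size Uf _ _).2; rewrite ?size_map //.
  by move=> _ /mapP[x + ->]; rewrite !mem_iota /f /=; lia.
rewrite [RHS]/nwords -(seq.permP (perm_permutations Ef)).
rewrite count_permutations_map ?iota_uniq //.
apply: eq_in_count => w /=; rewrite mem_permutations => /perm_mem ew.
by rewrite zigzag_map_anti // => x y; rewrite !ew; apply: anti.
Qed.

(** The step into [m] is an ascent, which fixes the parity of [size l]; the step out of [m] is a
    descent, so the pattern resumes in [r] with an ascent. *)
Lemma zigzag_cons_split (up : bool) (x m : nat) (l r : seq nat) :
  all (gtn m) (x :: l) -> all (gtn m) r ->
  zigzag up (x :: l ++ m :: r)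
    = [&& zigzag up (x :: l), up (+) odd (size l) & zigzag true r].
Proof.
elim: l x up => [|y l IHl] x up.
  move=> /= /andP[lt_xm _] ltr; case: up => /=; last by rewrite ltnNge ltnW.
  by rewrite lt_xm; case: r ltr => //= y r /andP[-> _].
case/andP=> lt_xm ltl ltr.
rewrite -[zigzag up (x :: y :: l)]/(_ && zigzag (~~ up) (y :: l)) -andbA.
rewrite -[zigzag up _]/(_ && zigzag (~~ up) (y :: l ++ m :: r)) IHl //.
by rewrite /= addbN -addNb.
Qed.

Lemma zigzag_split (l : seq nat) (m : nat) (r : seq nat) :
  all (gtn m) l -> all (gtn m) r ->
  zigzag false (l ++ m :: r) = (zigzag false l && ~~ odd (size l)) && zigzag true r.
Proof.
case: l => [|x l] ltl ltr; last by rewrite zigzag_cons_split ?andbA //= negbK.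
by case: r ltr => //= y r /andP[-> _].
Qed.

(** * Words with odd gaps *)

(* [p] is the part of the word already read, from right to left, so that
   [find (ltn x) p] is the number of entries strictly between [x] and the last
   greater entry.  If there is none, it is the distance from [x] to the start,
   where a virtual maximum sits, unless [head] allows left-to-right maxima. *)
Fixpoint odd_gaps (head : bool) (p s : seq nat) : bool :=
  if s is x :: s' then
    (head && ~~ has (ltn x) p || ~~ odd (find (ltn x) p))
      && odd_gaps head (x :: p) s'
  else true.

Lemma odd_gaps_cat (head : bool) (p l r : seq nat) :
  odd_gaps head p (l ++ r) = odd_gaps head p l && odd_gaps head (catrev l p) r.
Proof. by elim: l p => //= x l IHl p; rewrite IHl andbA. Qed.

(** The leftward search from an entry of [r] stops at [m] at the latest, so [m] acts as the virtual
    maximum; [q] is what has been read since [m]. *)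
Lemma odd_gaps_max (head : bool) (q p r : seq nat) (m : nat) :
  all (gtn m) r -> odd_gaps head (q ++ m :: p) r = odd_gaps false q r.
Proof.
elim: r q => //= x r IHr q /andP[lt_xm ltr]; rewrite -(IHr (x :: q)) //=.
rewrite has_cat /= lt_xm orbT andbF find_cat /= lt_xm addn0.
by case: ifPn => [//|/hasNfind ->].
Qed.

Lemma odd_gaps_invariant (head : bool) : order_invariant (odd_gaps head [::]).
Proof.
(* Writing the empty accumulator as an image under [f] lets the induction carry an arbitrary read
   part [p]. *)
move=> f s monof; rewrite -[X in odd_gaps head X (map f s)]/(map f [::]).
have : {in [::] ++ s &, {mono f : x y / x < y}} by [].
elim: s [::] {monof} => //= x s IHs p monof.
have E : {in p, preim f (ltn (f x)) =1 ltn x}.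
  by move=> y py /=; rewrite monof // !mem_cat ?py // mem_head orbT.
rewrite has_map find_map (eq_in_has E) (eq_in_find E) -(IHs (x :: p)) //.
by move=> y z; rewrite -!(perm_mem (permEl (perm_catCA p [:: x] s))); apply: monof.
Qed.

(** No entry before [m] is greater: either [m] is a permitted left-to-right maximum, or its distance
    [size l + 1] from the virtual maximum must be odd. This is the difference between U' = U V and
    V' = V_even V. *)
Lemma odd_gaps_split (head : bool) (l : seq nat) (m : nat) (r : seq nat) :
  all (gtn m) l -> all (gtn m) r ->
  odd_gaps head [::] (l ++ m :: r)
    = (odd_gaps head [::] l && (head || ~~ odd (size l))) && odd_gaps false [::] r.
Proof.
move=> ltl ltr; rewrite odd_gaps_cat /= -[m :: _]cat0s odd_gaps_max // catrevE cats0.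
have Nhas : ~~ has (ltn m) (rev l).
  by rewrite has_rev; apply/hasPn => x /(allP ltl) /= lt_xm; rewrite -leqNgt ltnW.
by rewrite Nhas hasNfind // size_rev andbT andbA.
Qed.

(** * Binomial convolution, the product of exponential generating functions *)

Definition conv (f g : nat -> nat) (n : nat) : nat :=
  \sum_(k < n.+1) 'C(n, k) * (f k * g (n - k)).

Lemma eq_conv (f f' g g' : nat -> nat) : f =1 f' -> g =1 g' -> conv f g =1 conv f' g'.
Proof. by move=> ef eg n; apply: eq_bigr => k _; rewrite ef eg. Qed.

Lemma convDl (f f' g : nat -> nat) (n : nat) :
  conv (fun k => f k + f' k) g n = conv f g n + conv f' g n.
Proof. by rewrite /conv -big_split; apply: eq_bigr => k _; rewrite mulnDl mulnDr. Qed.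

Lemma convDr (f g g' : nat -> nat) (n : nat) :
  conv f (fun k => g k + g' k) n = conv f g n + conv f g' n.
Proof. by rewrite /conv -big_split; apply: eq_bigr => k _; rewrite !mulnDr. Qed.

(* The product rule for the product of exponential generating functions. *)
Lemma convS (f g : nat -> nat) (n : nat) :
  conv f g n.+1 = conv (f \o S) g n + conv f (g \o S) n.
Proof.
rewrite /conv big_ord_recl /= bin0 subn0.
under eq_bigr do rewrite /bump /= add1n binS subSS mulnDl.
rewrite big_split /= addnA addnC; congr (_ + _).
transitivity (\sum_(k < n.+2) 'C(n, k) * (f k * g (n.+1 - k))).
  by rewrite [RHS]big_ord_recl bin0 subn0.
rewrite big_ord_recr /= bin_small // addn0.
by apply: eq_bigr => k _; rewrite subSn // -ltnS ltn_ord.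
Qed.

Lemma conv0 (f g : nat -> nat) : conv f g 0 = f 0 * g 0.
Proof. by rewrite /conv big_ord1 bin0 mul1n. Qed.

(** Induction on [n] for all sequences at once: composing with [S] is differentiation, so the
    product rule turns both sides at [n.+1] into the same three terms at [n]. *)
Lemma convA (f g h : nat -> nat) : conv (conv f g) h =1 conv f (conv g h).
Proof.
move=> n; elim: n f g h => [|n IHn] f g h; first by rewrite !conv0 mulnA.
rewrite !convS -!IHn (eq_conv (f' := fun k => _) (convS f g) (frefl h)) convDl.
by rewrite (eq_conv (frefl f) (g' := fun k => _) (convS g h)) convDr -!IHn addnA.
Qed.

Definition even_part (f : nat -> nat) (n : nat) : nat := if odd n then 0 else f n.
Definition odd_part (f : nat -> nat) (n : nat) : nat := if odd n then f n else 0.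

(* With [s], [t] the even and odd parts of [f], the equation [f' = s f] gives
   [s' = s t], hence [f'' = s t f + s (s f) = s f f = f' f]. *)
Lemma conv_second_order (f : nat -> nat) :
  (forall n, f n.+1 = conv (even_part f) f n) ->
  forall n, f n.+2 = conv (f \o S) f n.
Proof.
move=> fS n; set s := even_part f in fS *; pose t := odd_part f.
have sS k : s k.+1 = conv s t k.
  rewrite /s {1}/even_part /= fS /s /t; case: (boolP (odd k)) => odd_k /=.
    apply: eq_bigr => i _; rewrite /even_part /odd_part oddB -1?ltnS //.
    by rewrite odd_k; case: (odd i).
  symmetry; apply: big1 => i _; rewrite /even_part /odd_part oddB -1?ltnS //.
  by rewrite (negbTE odd_k); case: (odd i); rewrite ?muln0.
rewrite fS convS (eq_conv sS (frefl f)) (eq_conv (frefl s) fS) convA -convDr.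
rewrite (eq_conv fS (frefl f)) convA; apply: eq_conv => // k.
rewrite -convDl; apply: eq_conv => // i.
by rewrite /t /s /even_part /odd_part; case: (odd i); rewrite ?addn0.
Qed.

(** The linear equation f' = f h determines f from its value at 0, since each coefficient is
    computed from earlier ones. *)
Lemma conv_ind_eq (f g h : nat -> nat) :
  f 0 = g 0 -> (forall n, f n.+1 = conv f h n) -> (forall n, g n.+1 = conv g h n) ->
  f =1 g.
Proof.
move=> e0 fS gS n; elim/ltn_ind: n => -[//|n] IHn.
by rewrite fS gS; apply: eq_bigr => i _; rewrite IHn.
Qed.

(** * Recurrences for the word counts *)

Lemma nwords0 (P : pred (seq nat)) : P [::] -> nwords P 0 = 1.
Proof. by rewrite /nwords /= => ->. Qed.

(** The cut leaves a down-up word of even length and an up-down word; reversing the values counts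
    the latter as down-up words. *)
Lemma nwords_zigzagS (n : nat) :
  nwords (zigzag false) n.+1
    = conv (even_part (nwords (zigzag false))) (nwords (zigzag false)) n.
Proof.
rewrite (nwords_split (order_invariant_even (@zigzag_invariant false))
           (@zigzag_invariant true)); last first.
  by move=> l m r _ _; apply: zigzag_split.
by apply: eq_bigr => k _; rewrite nwords_even (nwords_zigzag_negb false).
Qed.

(** Both counts start at 1 and satisfy f' = f_even f, which computes each coefficient from earlier
    ones. *)
Lemma nwords_odd_gaps_false (n : nat) :
  nwords (odd_gaps false [::]) n = nwords (zigzag false) n.
Proof.
elim/ltn_ind: n => -[|n] IHn; first by rewrite !nwords0.
rewrite nwords_zigzagS.
rewrite (nwords_split (order_invariant_even (@odd_gaps_invariant false))
           (@odd_gaps_invariant false)); last first.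
  by move=> l m r _ _; apply: (odd_gaps_split false).
by apply: eq_bigr => k _; rewrite nwords_even !IHn // ltnS leq_subr.
Qed.

(** With A the series of down-up words, both sides solve the linear equation f' = f A: the left by
    the cut at the maximum and V = A, the right because A'' = A' A. *)
Lemma nwords_odd_gaps_true (n : nat) :
  nwords (odd_gaps true [::]) n = nwords (zigzag false) n.+1.
Proof.
apply: (conv_ind_eq (g := nwords (zigzag false) \o S)
         (h := nwords (zigzag false))) n => [|n|n].
- by rewrite /= nwords_zigzagS conv0 /even_part /= !nwords0.
- rewrite (nwords_split (@odd_gaps_invariant true) (@odd_gaps_invariant false)).
    by apply: eq_bigr => k _; rewrite nwords_odd_gaps_false.
  by move=> l m r _ _ ltl ltr; rewrite (odd_gaps_split true) // andbT.
- exact: conv_second_order nwords_zigzagS n.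
Qed.

(** * From permutations to words *)

Lemma card_perm_words (n : nat) (P : pred (seq nat)) :
  #|[set s : 'S_n | P (map val (one_line s))]| = nwords P n.
Proof.
pose W (s : 'S_n) := map val (one_line s).
have injW : injective W.
  move=> s t /(inj_map val_inj) /eq_in_map E.
  by apply/permP => i; apply: E; rewrite mem_enum.
have permW s : W s \in permutations (iota 0 n).
  rewrite mem_permutations -val_enum_ord; apply: perm_map.
  apply: uniq_perm; rewrite ?enum_uniq //.
    by rewrite map_inj_uniq ?enum_uniq //; apply: perm_inj.
  by move=> i; rewrite mem_enum; apply/mapP; exists (s^-1%g i); rewrite ?mem_enum ?permKV.
have UW : uniq (map W (enum 'S_n)) by rewrite map_inj_uniq ?enum_uniq.
have EW : perm_eq (map W (enum 'S_n)) (permutations (iota 0 n)).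
  apply: uniq_perm; rewrite ?permutations_uniq //.
  (* [W] is injective and both lists have n! elements, so inclusion is enough. *)
  apply: (uniq_min_size UW _ _).2; first by move=> _ /mapP[s _ ->].
  by rewrite size_permutations ?iota_uniq // size_iota size_map -cardE card_Sn.
rewrite /nwords -(seq.permP EW) count_map cardE -size_filter /enum_mem.
rewrite -filter_predI; congr size; apply: eq_filter => s.
by rewrite /= !inE andbT.
Qed.

Lemma zigzagP (up : bool) (w : seq nat) :
  reflect (forall i, i.+1 < size w ->
             if up (+) odd i then nth 0 w i < nth 0 w i.+1
             else nth 0 w i.+1 < nth 0 w i)
          (zigzag up w).
Proof.
elim: w up => [|x [|y w] IHw] up; try by left.
apply: (iffP andP) => [[xy /IHw zz] [|i] /= lt_i|zz].
- by rewrite addbF.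
- by have := zz i lt_i; rewrite addNb -addbN.
- split; first by have := zz 0 isT; rewrite addbF.
  by apply/IHw => i lt_i; have := zz i.+1 lt_i; rewrite addNb -addbN.
Qed.

Lemma num_alternating_nwords (n : nat) :
  num_alternating n = nwords (zigzag false) n.
Proof.
rewrite -card_perm_words; apply: eq_card => s; rewrite !inE.
have szW : size (map val (one_line s)) = n by rewrite 2!size_map size_enum_ord.
have nthW (i : 'I_n) : nth 0 (map val (one_line s)) i = s i.
  have lt_i : i < size (enum 'I_n) by rewrite size_enum_ord.
  by rewrite -map_comp (nth_map i) //= nth_ord_enum.
apply/idP/zigzagP => [/forallP alts i | zz].
  rewrite szW => lt_i1; have lt_i := ltnW lt_i1.
  have /forallP/(_ (Ordinal lt_i1))/implyP/(_ (eqxx _)) := alts (Ordinal lt_i).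
  by rewrite -!nthW.
apply/forallP => i; apply/forallP => j; apply/implyP => /eqP ij.
by have := zz i; rewrite szW -ij => /(_ (ltn_ord j)); rewrite -!nthW.
Qed.

(** * Trees given by a parent function *)

Lemma adj_sym (T : finType) (G : sgraph T) : symmetric (adj G).
Proof. by move=> x y; rewrite /adj /= setUC. Qed.

Section ParentForest.

Variables (T : finType) (F : sgraph T) (x0 : T) (s : seq T) (parent : nat -> nat).
Hypothesis Us : uniq s.
Hypothesis s_gt0 : 0 < size s.
Hypothesis vsetF : vset F = [set x in s].
Hypothesis parent_lt : forall i, 0 < i < size s -> parent i < i.
Hypothesis esetF : forall A,
  reflect (exists2 i, 0 < i < size s & A = [set nth x0 s (parent i); nth x0 s i])
          (A \in eset F).

(** Passing to the parent lowers the position, so every vertex is linked to the entry at position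
    0. *)
Lemma parent_connected : connected F.
Proof.
have root i : i < size s -> connect (adj F) (nth x0 s 0) (nth x0 s i).
  elim/ltn_ind: i => -[//|i] IHi lt_i.
  have lt_p := parent_lt (i := i.+1) lt_i.
  apply: connect_trans (IHi _ lt_p (ltn_trans lt_p lt_i)) (connect1 _).
  by apply/esetF; exists i.+1.
apply/andP; split.
  by apply/set0Pn; exists (nth x0 s 0); rewrite vsetF inE mem_nth.
apply/forall_inP => x; rewrite vsetF inE => xs.
apply/forall_inP => y; rewrite inE => ys.
apply: (@connect_trans _ _ (nth x0 s 0)).
  rewrite (sym_connect_sym (adj_sym F)).
  by rewrite -(nth_index x0 xs) root ?index_mem.
by rewrite -(nth_index x0 ys) root ?index_mem.
Qed.

(** In each edge the parent has the smaller position, so the endpoint at the larger position is the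
    child. *)
Lemma adj_parent (x y : T) :
  adj F x y -> index y s <= index x s -> y = nth x0 s (parent (index x s)).
Proof.
rewrite /adj /= => /esetF[i lt_i E] le_yx.
have /andP[i_gt0 i_lt] := lt_i; have p_lt := parent_lt lt_i.
have p_size := ltn_trans p_lt i_lt.
have Ni : nth x0 s i != nth x0 s (parent i) by rewrite nth_uniq // gtn_eqF.
have := set21 x y; rewrite E !inE => /orP[] /eqP Ex; last first.
  have : nth x0 s (parent i) \in [set x; y] by rewrite E !inE eqxx.
  by rewrite Ex !inE eq_sym (negbTE Ni) index_uniq //= => /eqP.
have : nth x0 s i \in [set x; y] by rewrite E !inE eqxx orbT.
rewrite Ex !inE (negbTE Ni) /= => /eqP Ey.
by move: le_yx; rewrite Ex -Ey !index_uniq // leqNgt p_lt.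
Qed.

(* In a cycle, both neighbours of the vertex of largest index would be its
   parent. *)
Lemma parent_acyclic : acyclic F.
Proof.
apply/acyclicP => c c_gt2 /andP[cycF Uc].
have [x1 x1c] : exists x1, x1 \in c.
  by case: c c_gt2 {cycF Uc} => // x c; exists x; rewrite mem_head.
case: (@arg_maxnP _ x1 (mem c) (index^~ s) x1c) => x xc maxx.
(* Once the cycle is rotated to start at [x], the neighbours of [x] are the second and the last
   entry, which differ because the length is at least 3. *)
have [i c' Ec] := rot_to xc.
have memc y : y \in x :: c' -> index y s <= index x s.
  by rewrite -Ec mem_rot => /maxx.
move: cycF Uc c_gt2; rewrite -(rot_cycle i) -(rot_uniq i) -(size_rot i) {}Ec.
case: c' memc => [//|y c'] memc; case/lastP: c' memc => [//|c' z] memc.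
rewrite /= rcons_path last_rcons => /and3P[Fxy _ Fzx] /and3P[_ yz _] _.
have Ey := adj_parent Fxy (memc y _); have Ez : z = y.
  rewrite [RHS]Ey ?inE ?eqxx ?orbT //; apply: adj_parent; first by rewrite adj_sym.
  by apply: memc; rewrite !inE mem_rcons mem_head !orbT.
by move: yz; rewrite mem_rcons Ez mem_head.
Qed.

Lemma parent_is_tree : is_tree F.
Proof. by rewrite /is_tree parent_connected parent_acyclic. Qed.

End ParentForest.

(** * Odd permutations of complete graphs *)

Lemma bigmax_find (T : Type) (x0 : T) (a : pred T) (s : seq T) (i : nat) :
  i <= size s ->
  \max_(0 <= k < i | a (nth x0 s k)) k = i - (find a (rev (take i s))).+1.
Proof.
elim: i => [|i IHi] le_i; first by rewrite big_geq.
rewrite big_mkcond big_nat_recr //= -big_mkcond IHi ?(ltnW le_i) //.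
rewrite (take_nth x0) // rev_rcons /=; case: (a _); lia.
Qed.

(** The search runs leftwards from position [i], and [find] counts the entries it skips. If it finds
    nothing, truncated subtraction gives 0, the value of the empty maximum. *)
Lemma last_greater_find (n : nat) (x0 : 'I_n) (s : seq 'I_n) (i : nat) :
  i <= size s ->
  last_greater x0 s i
    = i - (find (fun y : 'I_n => nth x0 s i < y) (rev (take i s))).+1.
Proof.
by move=> le_i; rewrite -(bigmax_find x0) //; apply: eq_bigl => k; rewrite ltEord.
Qed.

Lemma adj_induced_K (n : nat) (A : {set 'I_n}) (x y : 'I_n) :
  x \in A -> y \in A -> adj (induced (K n) A) x y = (x != y).
Proof.
by move=> xA yA; rewrite /adj /= !inE cards2 subUset !sub1set xA yA; case: (x != y).
Qed.

(** Distinct vertices are adjacent, so the filter in [Ntilde] keeps every position. *)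
Lemma Ntilde_complete (n : nat) (x0 : 'I_n) (s : seq 'I_n) (i : nat) :
  uniq s -> i < size s ->
  Ntilde (induced (K n) [set x in s]) x0 s i
    = iota (last_greater x0 s i) (i - last_greater x0 s i).
Proof.
move=> Us lt_i; apply/all_filterP/allP => k; rewrite mem_index_iota => /andP[_ lt_k].
have lt_ks := ltn_trans lt_k lt_i.
by rewrite adj_induced_K ?inE ?mem_nth // nth_uniq // ltn_eqF.
Qed.

(** Turns the recursion into a condition on positions, the form used by [odd_perm_of]; [u] is the
    part already read. *)
Lemma odd_gaps_all (u r : seq nat) :
  odd_gaps false (rev u) r
    = all (fun i => ~~ odd (find (ltn (nth 0 (u ++ r) i)) (rev (take i (u ++ r)))))
          (iota (size u) (size r)).
Proof.
elim: r u => //= x r IHr u.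
rewrite -rev_rcons IHr size_rcons cat_rcons.
by rewrite nth_cat ltnn subnn /= take_size_cat.
Qed.

(** Here [Ntilde] is the whole interval from the last greater entry up to [i]. Its first element
    serves as the parent of [i], so the forest is always a spanning tree and only the parity
    condition remains. *)
Lemma odd_perm_of_complete (n : nat) (m : 'I_n) (r : seq 'I_n) :
  uniq (m :: r) -> all (gtn m) (map val r) ->
  odd_perm_of (induced (K n) [set x in m :: r]) (m :: r)
    = odd_gaps false [::] (map val r).
Proof.
set s := m :: r => Us ltr; rewrite /odd_perm_of {1}/s.
set H := induced _ _; have vsetH : vset H = [set x in s] by rewrite -[RHS]setTI.
have last_lt i : 0 < i < size s -> last_greater m s i < i.
  by case/andP=> i_gt0 lt_i; rewrite last_greater_find ?(ltnW lt_i) //; lia.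
have EN i : 0 < i < size s -> Ntilde H m s i
    = last_greater m s i :: iota (last_greater m s i).+1 (i - (last_greater m s i).+1).
  move=> i_bd; case/andP: (i_bd) => _ lt_i.
  by rewrite Ntilde_complete // -[i - _]prednK ?subn_gt0 ?last_lt //= subnS.
have -> : perm_eq s (enum (vset H)).
  apply: uniq_perm; rewrite ?enum_uniq // => x.
  by rewrite mem_enum vsetH in_set.
have -> : [forall v in vset H, (v <= m)%O].
  apply/forall_inP => v; rewrite vsetH in_set leEord inE => /predU1P[-> //|vr].
  by apply/ltnW/(allP ltr)/map_f.
have edges i : i < size s -> forall A,
    reflect (exists2 k, 0 < k < i.+1 & A = [set nth m s (last_greater m s k); nth m s k])
            (A \in forest_edges H m s i).
  elim: i => [|i IHi] lt_i A.
    by rewrite inE; right=> -[[|k] //].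
  rewrite -[forest_edges _ _ _ _]/(if Ntilde H m s i.+1 is k0 :: _ then
    [set nth m s k0; nth m s i.+1] |: forest_edges H m s i
    else forest_edges H m s i) EN // in_setU1.
  apply: (iffP orP) => [[/eqP ->|/IHi]|[k]].
  - by exists i.+1; rewrite ?leqnn.
  - by case/(_ (ltnW lt_i)) => k /andP[k_gt0 lt_k] ->; exists k; rewrite // k_gt0 ltnW.
  - case/andP=> k_gt0; rewrite ltnS leq_eqVlt => /predU1P[-> ->|lt_k ->]; first by left.
    by right; apply/IHi; [apply: ltnW | exists k; rewrite // k_gt0].
have -> : spanning_tree (forest H m s) H.
  rewrite /spanning_tree eqxx forest_edges_sub /=.
  apply: (@parent_is_tree _ _ m s (last_greater m s)) => // A.
  exact: (edges (size r)).
(* The leading [m] counts as already read and replaces the virtual maximum, so the positions to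
   check start at 1. *)
rewrite /= -(@odd_gaps_max false [::] [::] _ _ ltr) -[[::] ++ _]/(rev [:: val m]).
rewrite odd_gaps_all size_map /index_iota subn1.
apply: eq_in_all => i; rewrite mem_iota => /andP[i_gt0 lt_i].
have {}lt_i : i < size s by rewrite /s /=; move: lt_i => /=; lia.
rewrite -[_ ++ _]/(map val s) (nth_map m) // -map_take -map_rev find_map.
rewrite Ntilde_complete // size_iota last_greater_find ?(ltnW lt_i) //.
set f := find _ _.
(* The search stops at [m] in position 0 at the latest, so the subtraction is not truncated and the
   interval has [f.+1] elements, an odd number exactly when [f] is even. *)
have lt_f : f < i.
  rewrite -[X in _ < X](size_takel (ltnW lt_i)) -size_rev -has_find has_rev.
  apply/hasP; exists m.
    by rewrite /s; case: (i) i_gt0 => //= k _; rewrite mem_head.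
  have := mem_nth m lt_i; rewrite inE => /predU1P[E|/(map_f val)/(allP ltr) //].
  have : nth m s i != nth m s 0 by rewrite nth_uniq // gtn_eqF.
  by rewrite E eqxx.
by rewrite subKn.
Qed.


(** * The basic decomposition and the final count *)

Lemma foldr_max_mem (d : Order.disp_t) (T : orderType d) (x : T) (s : seq T) :
  foldr Order.max x s \in x :: s.
Proof.
elim: s => [|y s IHs] /=; first exact: mem_head.
rewrite maxElt; case: ifP => _; last by rewrite !inE eqxx orbT.
by move: IHs; rewrite !inE => /orP[] ->; rewrite ?orbT.
Qed.

Lemma foldr_max_ge (d : Order.disp_t) (T : orderType d) (x : T) (s : seq T) :
  all (fun y => y <= foldr Order.max x s)%O (x :: s).
Proof.
elim: s => [|y s IHs] /=; first by rewrite lexx.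
rewrite !le_max lexx /=.
case/andP: IHs => -> /allP les; rewrite orbT /=.
by apply/allP => z /les; rewrite le_max => ->; rewrite orbT.
Qed.

(** The factor sigma_1 is [m :: r] with [m] the maximum, and the other factors decompose the prefix
    [l]; [odd_gaps_split] with [head] true cuts the word in the same way. *)
Lemma basic_decomp_complete (n : nat) (w : seq 'I_n) :
  uniq w ->
  all (fun b => odd_perm_of (induced (K n) [set x in b]) b) (basic_decomp w)
    = odd_gaps true [::] (map val w).
Proof.
rewrite /basic_decomp; have: size w <= size w by [].
(* The fuel becomes any bound on the length, because the recursive call loses one unit of fuel while
   the prefix may be much shorter. *)
move: {2 3}(size w) => k; elim: k w => [|k IHk] [|x s] // le_wk Uw.
rewrite [basic_decomp_rec _ _]/= -[if _ then _ else _]/(index _ (x :: s)).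
have := foldr_max_ge x s; have := foldr_max_mem x s.
move: (foldr _ _ _) => m mw; case/splitPr: mw Uw le_wk => l r Uw le_wk /allP le_m.
have [Ul nml Ur] : [/\ uniq l, m \notin l & uniq (m :: r)].
  by move: Uw; rewrite cat_uniq /= negb_or => /and3P[-> /andP[-> _] ->].
have lt_m u : {subset u <= l ++ m :: r} -> m \notin u -> all (gtn m) (map val u).
  move=> sub nmu; apply/allP => _ /mapP[y yu ->] /=.
  have := le_m _ (sub _ yu); rewrite leEord leq_eqVlt => /predU1P[/val_inj ym|//].
  by rewrite -ym yu in nmu.
have ltl : all (gtn m) (map val l).
  by apply: lt_m => // y yl; rewrite mem_cat yl.
have ltr : all (gtn m) (map val r).
  apply: lt_m; last by case/andP: Ur.
  by move=> y yr; rewrite mem_cat inE yr !orbT.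
have Ei : index m (l ++ m :: r) = size l by rewrite index_cat (negbTE nml) /= eqxx addn0.
rewrite Ei drop_size_cat // take_size_cat //.
rewrite -[all _ (_ :: _)]/(_ && all _ (basic_decomp_rec _ _)) IHk //; last first.
  by move: le_wk; rewrite size_cat /=; lia.
by rewrite odd_perm_of_complete // map_cat odd_gaps_split // andbT andbC.
Qed.

Theorem theorem1p3 (n : nat) (hn : 0 < n) :
  #|Upsilon_odd (K n)| = num_alternating n.+1.
Proof.
rewrite num_alternating_nwords -nwords_odd_gaps_true -card_perm_words.
apply: eq_card => s; rewrite !inE basic_decomp_complete //.
by rewrite map_inj_uniq ?enum_uniq //; apply: perm_inj.
Qed.
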